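(* Let $(S,+,\circ)$ be a dual weak brace and let $I,J$ be ideals of $S$. Then $I+J=\{i+j\mid i\in I,\ j\in J\}$ and $I\circ J=\{i\circ j\mid i\in I,\ j\in J\}$ are ideals of $S$.
   Context: A Clifford semigroup is an inverse semigroup with central idempotents. A weak brace is a triple $(S,+,\circ)$ such that $(S,+)$ and $(S,\circ)$ are inverse semigroups and, for all $a,b,c\in S$, $a\circ(b+c)=a\circ b-a+a\circ c$ and $a\circ a^-=-a+a$, where $-a$ and $a^-$ are the inverses of $a$ in $(S,+)$ and $(S,\circ)$ respectively, and $\circ$ has higher precedence than $+$. In a weak brace, $(S,+)$ is always a Clifford semigroup, and the idempotents of $(S,+)$ and $(S,\circ)$ coincide. A dual weak brace is a weak brace in which $(S,\circ)$ is a Clifford semigroup. For $a,b\in S$, $\lambda_a(b):=-a+a\circ b$. A subset $N$ of a Clifford semigroup $S$ (written multiplicatively, with $a^0=aa^{-1}=a^{-1}a$ and $E(S)$ the set of idempotents) is normal if: (1) $E(S)\subseteq N$; (2) $a\in N\Rightarrow a^{-1}\in N$; (3) $a,\ a^0b\in N\Rightarrow ab\in N$; (4) $ab\in N\Rightarrow ba\in N$, for all $a,b\in S$. An ideal of a dual weak brace $(S,+,\circ)$ is a subset $I\subseteq S$ such that $I$ is a normal subset of $(S,+)$, $\lambda_a(I)\subseteq I$ for every $a\in S$, and $I$ is a normal subset of $(S,\circ)$. *)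

(* Defs.v *)
From mathcomp Require Import all_boot.
From mathcomp Require Import classical_sets.

Set Implicit Arguments.
Unset Strict Implicit.
Unset Printing Implicit Defensive.

Local Open Scope classical_set_scope.

Section Semigroups.
Variables (T : Type) (op : T -> T -> T) (inv : T -> T).

Definition is_inverse_of (a x : T) : Prop :=
  op (op a x) a = a /\ op (op x a) x = x.

Record is_inverse_semigroup : Prop := IsInverseSemigroup {
  isg_assoc : associative op;
  isg_inv : forall a, is_inverse_of a (inv a);
  isg_uniq : forall a x, is_inverse_of a x -> x = inv a
}.

Definition idempotents : set T := [set e | op e e = e].

Definition is_clifford_semigroup : Prop :=
  is_inverse_semigroup /\
  forall e a, idempotents e -> op e a = op a e.

(* op a (inv a) is a^0; it equals op (inv a) a in a Clifford semigroup. *)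
Record is_normal_subset (N : set T) : Prop := IsNormalSubset {
  normal_idem : idempotents `<=` N;
  normal_inv : forall a, N a -> N (inv a);
  normal_op : forall a b, N a -> N (op (op a (inv a)) b) -> N (op a b);
  normal_comm : forall a b, N (op a b) -> N (op b a)
}.

End Semigroups.

Declare Scope brace_scope.
Delimit Scope brace_scope with brace.
Local Open Scope brace_scope.

Record weakBrace := WeakBrace {
  wb_sort :> Type;
  wb_add : wb_sort -> wb_sort -> wb_sort;
  wb_opp : wb_sort -> wb_sort;
  wb_circ : wb_sort -> wb_sort -> wb_sort;
  wb_inv : wb_sort -> wb_sort;
  wb_add_inverse : is_inverse_semigroup wb_add wb_opp;
  wb_circ_inverse : is_inverse_semigroup wb_circ wb_inv;
  wb_circDr : forall a b c,
    wb_circ a (wb_add b c) =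
    wb_add (wb_add (wb_circ a b) (wb_opp a)) (wb_circ a c);
  wb_circV : forall a, wb_circ a (wb_inv a) = wb_add (wb_opp a) a
}.

Notation "a + b" := (wb_add a b) : brace_scope.
Notation "- a" := (wb_opp a) : brace_scope.
Notation "a ∘ b" := (wb_circ a b) (at level 40, left associativity) :
  brace_scope.

Record dualWeakBrace := DualWeakBrace {
  dwb_brace :> weakBrace;
  dwb_clifford : is_clifford_semigroup (@wb_circ dwb_brace) (@wb_inv dwb_brace)
}.

Definition lambda (S : weakBrace) (a b : S) : S := - a + a ∘ b.

Record is_ideal (S : dualWeakBrace) (I : set S) : Prop := IsIdeal {
  ideal_add_normal : is_normal_subset (@wb_add S) (@wb_opp S) I;
  ideal_lambda : forall a : S, lambda a @` I `<=` I;
  ideal_circ_normal : is_normal_subset (@wb_circ S) (@wb_inv S) I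
}.

(* Main.v *)
(** Both reducts of a dual weak brace are Clifford semigroups with the same
    idempotents, and [e ∘ a = e + a] for [e] idempotent.  Hence
    [i ∘ j = i + lambda i j] and [i + j = i ∘ lambda (i^-) j], so that
    [I + J] and [I ∘ J] are the same set.  In a Clifford semigroup the product
    of two normal subsets is normal; applied to [+] and to [∘], this gives both
    normality conditions, and [lambda a] is additive. *)

Require Import Defs.
From mathcomp Require Import all_boot.
From mathcomp Require Import classical_sets.

Local Open Scope classical_set_scope.
Local Open Scope brace_scope.

Set Implicit Arguments.
Unset Strict Implicit.

(** * Inverse semigroups and their commuting idempotents *)

Section InverseSemigroup.
Variables (T : Type) (op : T -> T -> T) (inv : T -> T).
Hypothesis inverse_op : is_inverse_semigroup op inv.
Local Notation "x * y" := (op x y).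
Local Notation "x ^v" := (inv x) (at level 3, format "x ^v").
Local Notation idem := (idempotents op).

Let opA : associative op. Proof. exact: isg_assoc inverse_op. Qed.

Lemma opVK a : a * a^v * a = a.
Proof. by case: (isg_inv inverse_op a). Qed.

Lemma invVK a : a^v * a * a^v = a^v.
Proof. by case: (isg_inv inverse_op a). Qed.

Lemma inv_unique a x : a * x * a = a -> x * a * x = x -> a^v = x.
Proof. by move=> h1 h2; rewrite (isg_uniq inverse_op (conj h1 h2)). Qed.

Lemma inv_involutive : involutive inv.
Proof. by move=> a; apply: inv_unique; rewrite ?opVK ?invVK. Qed.

Lemma inv_idem e : idem e -> e^v = e.
Proof. by move=> ee; apply: inv_unique; rewrite !ee. Qed.

Lemma idem_opV a : idem (a * a^v).
Proof. by rewrite /idempotents /= opA opVK. Qed.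

Lemma idem_Vop a : idem (a^v * a).
Proof. by rewrite /idempotents /= opA invVK. Qed.

Lemma idem_op e f : idem e -> idem f -> idem (e * f).
Proof.
move=> ee ff; set x := (e * f)^v.
have xefx : x * e * f * x = x by rewrite -(opA x); exact: invVK.
(* [f * x * e] is again an inverse of [e * f]. *)
have xE : x = f * x * e.
  apply: inv_unique.
    rewrite !opA -(opA e f f) ff -(opA _ e e) ee -(opA (e * f * x)).
    exact: opVK.
  rewrite !opA -(opA _ e e) ee -(opA _ f f) ff.
  by rewrite -(opA f x e) -(opA f _ f) -(opA f _ x) xefx.
have xx : idem x.
  rewrite /idempotents /= {1}xE {2}xE !opA.
  by rewrite -(opA f x e) -(opA f _ f) -(opA f _ x) xefx -xE.
suff -> : e * f = x by [].
by rewrite -[LHS]inv_involutive -/x inv_idem.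
Qed.

(** [e * f] is idempotent, hence its own inverse; [f * e] is an inverse of it too, and inverses are
    unique. *)
Lemma idemC e f : idem e -> idem f -> e * f = f * e.
Proof.
move=> ee ff.
rewrite -[LHS](inv_idem (idem_op ee ff)).
have ef := idem_op ee ff; have fe := idem_op ff ee.
rewrite /idempotents /= in ef fe ee ff.
apply: inv_unique.
  by rewrite !opA -(opA e f f) ff -(opA (e * f)) ee -(opA (e * f)) ef.
by rewrite !opA -(opA f e e) ee -(opA (f * e)) ff -(opA (f * e)) fe.
Qed.

Lemma invM a b : (a * b)^v = b^v * a^v.
Proof.
have c := idemC (idem_Vop a) (idem_opV b).
apply: inv_unique.
  have : a * (b * b^v * (a^v * a)) * b = a * b.
    by rewrite -c !opA opVK -(opA a b) -(opA a) opVK.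
  by rewrite !opA.
have : b^v * (a^v * a * (b * b^v)) * a^v = b^v * a^v.
  by rewrite c !opA invVK -(opA _ a^v) -(opA _ (a^v * a)) invVK.
by rewrite !opA.
Qed.

(** At [e * a] the hypothesis reduces to [e * (a * a^v) = a^v * e * a]; left multiplication by [a]
    turns this into [a * e = e * a]. *)
Lemma clifford_of_opVC : (forall a, a * a^v = a^v * a) ->
  is_clifford_semigroup op inv.
Proof.
move=> opVC; split=> // e a ee.
have h : e * a * (e * a)^v = (e * a)^v * (e * a) by exact: opVC.
rewrite invM (inv_idem ee) !opA -(opA _ e e) ee -(opA e a) in h.
rewrite -(opA e _ e) -(idemC ee (idem_opV a)) opA ee in h.
have := congr1 (op a) h.
rewrite (idemC ee (idem_opV a)) {1}opVC !opA opVK => ->.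
by rewrite -(idemC ee (idem_opV a)) -(opA e) opVK.
Qed.

End InverseSemigroup.

(** * Normal subsets of a Clifford semigroup and their products *)

Section CliffordSemigroup.
Variables (T : Type) (op : T -> T -> T) (inv : T -> T).
Hypothesis clifford_op : is_clifford_semigroup op inv.
Local Notation "x * y" := (op x y).
Local Notation "x ^v" := (inv x) (at level 3, format "x ^v").
Local Notation idem := (idempotents op).
Local Notation normal := (is_normal_subset op inv).

Let inverse_op : is_inverse_semigroup op inv. Proof. by case: clifford_op. Qed.
Let opA : associative op. Proof. exact: isg_assoc inverse_op. Qed.

Lemma idem_central e (ee : idem e) a : e * a = a * e.
Proof. by case: clifford_op => _; exact. Qed.

(** By centrality, each of these two idempotents equals their product. *)
Lemma opVC a : a * a^v = a^v * a.
Proof.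
have h : a * a^v = (a^v * a) * (a * a^v).
  rewrite opA (idem_central (idem_Vop inverse_op a)) !opA.
  by rewrite -(opA (a * a^v)) (idem_opV inverse_op).
rewrite h -(idem_central (idem_opV inverse_op a)) opA.
rewrite (idem_central (idem_opV inverse_op a)) !opA.
by rewrite (invVK inverse_op).
Qed.

Section NormalSubset.
Variable N : set T.
Hypothesis normalN : normal N.

Lemma normal_mul_idem e a : idem e -> N a -> N (a * e).
Proof.
move=> ee Na; apply: (normal_op normalN) => //; apply: (normal_idem normalN).
exact: (idem_op inverse_op) (idem_opV inverse_op a) ee.
Qed.

Lemma normal_mul a b : N a -> N b -> N (a * b).
Proof.
move=> Na Nb; apply: (normal_op normalN) => //.
rewrite (idem_central (idem_opV inverse_op a)).
exact: normal_mul_idem (idem_opV inverse_op a) Nb.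
Qed.

(** Cyclic exchange reduces the claim to [x * (a^v * a)], the product of [x] and an idempotent. *)
Lemma normal_conj a x : N x -> N (a * x * a^v).
Proof.
move=> Nx; rewrite -opA; apply: (normal_comm normalN); rewrite -opA.
exact: normal_mul_idem (idem_Vop inverse_op a) Nx.
Qed.

End NormalSubset.

(** The last two axioms of normality follow from [a * b = a * (a * a^v * b)] and
    [b * a = b * (a * b) * b^v]. *)
Lemma normal_of_conj (N : set T) : idem `<=` N ->
  (forall a, N a -> N a^v) -> (forall a b, N a -> N b -> N (a * b)) ->
  (forall a x, N x -> N (a * x * a^v)) -> normal N.
Proof.
move=> NE NV NM NJ; split=> // a b.
  have -> : a * b = a * (a * a^v * b) by rewrite opVC !opA (opVK inverse_op).
  exact: NM.
move=> Nab; suff -> : b * a = b * (a * b) * b^v by exact: NJ.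
rewrite !opA -(opA (b * a)) -(idem_central (idem_opV inverse_op b)) opA.
by rewrite (opVK inverse_op).
Qed.

Lemma normal_setM (N M : set T) : normal N -> normal M ->
  normal [set x * y | x in N & y in M].
Proof.
move=> nN nM; apply: normal_of_conj.
- move=> e ee; exists e; first exact: normal_idem nN _ ee.
  by exists e; [exact: normal_idem nM _ ee | ].
(* The inverse [y^v * x^v] absorbs the central idempotent [y * y^v], so it factors as a conjugate of
   [x^v] times [y^v]. *)
- move=> _ [x Nx [y My <-]]; exists (y^v * x^v * y).
    have := normal_conj nN (y^v) (normal_inv nN Nx).
    by rewrite (inv_involutive inverse_op).
  exists y^v; first by apply: (normal_inv nM).
  rewrite (invM inverse_op) -(opA _ y) (opVC y).
  rewrite -(idem_central (idem_Vop inverse_op y)) opA.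
  by rewrite (invVK inverse_op).
- move=> _ _ [x Nx [y My <-]] [z Nz [t Mt <-]].
  (* Conjugation by [y] moves [z] past [y]: the product regroups as
     [(x * (y * z * y^v)) * (y * t)]. *)
  exists (x * (y * z * y^v)).
    by apply: (normal_mul nN) => //; exact: normal_conj.
  exists (y * t); first exact: normal_mul.
  rewrite !opA -(opA _ y^v y).
  rewrite -(opA _ z (y^v * y)) -(idem_central (idem_Vop inverse_op y) z).
  by rewrite !opA -(opA x y) -(opA x) (opVK inverse_op).
- move=> a _ [x Nx [y My <-]].
  exists (a * x * a^v); first exact: normal_conj.
  exists (a * y * a^v); first exact: normal_conj.
  rewrite !opA -(opA _ a^v a) -(opA a x (a^v * a)).
  rewrite -(idem_central (idem_Vop inverse_op a) x) !opA.
  by rewrite (opVK inverse_op).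
Qed.

End CliffordSemigroup.

(** * Idempotents and the additive structure of a dual weak brace *)

Section DualWeakBrace.
Variable S : dualWeakBrace.
Implicit Types a b c e f : S.
Local Notation "a ^v" := (wb_inv a) (at level 3, format "a ^v") : brace_scope.
Local Notation idem := (idempotents (@wb_add S)).

Let addA : associative (@wb_add S).
Proof. exact: isg_assoc (wb_add_inverse S). Qed.

Let circA : associative (@wb_circ S).
Proof. exact: isg_assoc (wb_circ_inverse S). Qed.

Let addI := wb_add_inverse S.
Let circI := wb_circ_inverse S.

(** An idempotent is its own inverse, so [wb_circV] exhibits it as an idempotent of the other
    operation. *)
Lemma idem_circE e : idempotents (@wb_circ S) e <-> idem e.
Proof.
split=> ee.
  have <- : e ∘ e^v = e by rewrite (inv_idem circI ee).
  by rewrite wb_circV; exact: idem_Vop addI e.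
have <- : e ∘ e^v = e by rewrite wb_circV (inv_idem addI ee).
exact: idem_opV circI e.
Qed.

Lemma circ_idem_central e a : idem e -> e ∘ a = a ∘ e.
Proof. by move/idem_circE => ee; exact: idem_central (dwb_clifford S) e ee a. Qed.

Lemma circ_idem e f : idem e -> idem f -> e ∘ f = e + f.
Proof.
(* In the additive order of idempotents, [e1 ∘ e2] lies below [e1]: expand [e1 ∘ (e2 + e2)]. *)
have le_circ e1 e2 : idem e1 -> idem e2 -> e1 + e1 ∘ e2 = e1 ∘ e2.
  move=> ee ff; have ef : idem (e1 ∘ e2).
    by apply/idem_circE; apply: (idem_op circI); exact/idem_circE.
  have := wb_circDr e1 e2 e2; rewrite ff (inv_idem addI ee).
  by rewrite (idemC addI ef ee) -addA ef => <-.
have circ_add e1 e2 : idem e1 -> idem e2 -> e1 ∘ (e1 + e2) = e1 ∘ e2.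
  move=> ee ff; rewrite wb_circDr (inv_idem addI ee).
  have -> : e1 ∘ e1 = e1 by exact: (idem_circE e1).2.
  by rewrite ee le_circ.
move=> ee ff; have gg := idem_op addI ee ff.
have ge : (e + f) ∘ e = e ∘ f by rewrite (circ_idem_central _ gg) circ_add.
have gf : (e + f) ∘ f = e ∘ f.
  rewrite (circ_idem_central _ gg) (idemC addI ee ff) circ_add //.
  exact: circ_idem_central.
have ef : idem (e ∘ f).
  by apply/idem_circE; apply: (idem_op circI); exact/idem_circE.
(* Expanding [(e + f) ∘ (e + f) = e + f] gives [e + f = (e + f) + e ∘ f], which is [e ∘ f] by
   [le_circ]. *)
have := wb_circDr (e + f) e f; rewrite (inv_idem addI gg).
have -> : (e + f) ∘ (e + f) = e + f by exact: (idem_circE (e + f)).2.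
rewrite ge gf (idemC addI ef gg) -addA ef => ->.
by rewrite -gf le_circ.
Qed.

Lemma oppC a : a + - a = - a + a.
Proof.
(* Expanding [x = (- x + x) ∘ ((x + - x) + x)] gives [x + - x <= - x + x] in the
   order of idempotents; applied to [- a], this is the reverse inequality. *)
have le (x : S) : (x + - x) + (- x + x) = x + - x.
  have ee := idem_Vop addI x; have ff := idem_opV addI x.
  have h : x = (x + - x) + (- x + x) + x.
    have e0 : (- x + x) ∘ x = x by rewrite -wb_circV (opVK circI).
    have := wb_circDr (- x + x) (x + - x) x.
    rewrite (opVK addI) e0 circ_idem // (inv_idem addI ee).
    by rewrite (idemC addI ee ff) -(addA (x + - x) _ (- x + x)) ee.
  have := congr1 (fun y => y + - x) h.
  by rewrite -(addA _ x) -(addA (x + - x)) (idemC addI ee ff) addA ff.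
have := le (- a); rewrite (inv_involutive addI) => h.
by rewrite -[LHS]le (idemC addI (idem_opV addI a) (idem_Vop addI a)).
Qed.

Lemma add_clifford : is_clifford_semigroup (@wb_add S) (@wb_opp S).
Proof. exact: clifford_of_opVC addI oppC. Qed.

(** Expanding [a ∘ (b + (- b + b))] produces a summand [- a], which absorbs the central idempotent
    [a + - a]. *)
Lemma add_circK a b : (a + - a) + a ∘ b = a ∘ b.
Proof.
have := wb_circDr a b (- b + b); rewrite addA (opVK addI) => ->.
rewrite addA (idem_central add_clifford (idem_opV addI a)).
by rewrite -(addA _ (- a)) (addA (- a)) (invVK addI).
Qed.

Lemma circ_idem_add e a : idem e -> e ∘ a = e + a.
Proof.
move=> ee.
(* Since [c = (- c + c) ∘ c], the action of [e] on [c] is decided among idempotents, where both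
   operations agree. *)
have eK c : e + (- c + c) = - c + c -> e ∘ c = c.
  move=> h; have c0 := idem_Vop addI c.
  rewrite -{1}(opVK circI c) wb_circV circA (circ_idem ee c0) h.
  by rewrite -wb_circV (opVK circI).
have add_eK : e ∘ (e + a) = e + a.
  apply: eK; rewrite (invM addI) (inv_idem addI ee) !addA.
  by rewrite (idem_central add_clifford ee (- a)) -(addA (- a) e e) ee
     -(addA (- a) e) ee.
rewrite -[RHS]add_eK wb_circDr (inv_idem addI ee).
rewrite ((idem_circE e).2 ee) -[LHS]add_circK.
by rewrite (inv_idem addI ee).
Qed.

(** * The maps [lambda a] and the passage between the two operations *)

Lemma add_lambda a b : a + lambda a b = a ∘ b.
Proof. by rewrite /lambda addA add_circK. Qed.

Lemma lambdaD a b c : lambda a (b + c) = lambda a b + lambda a c.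
Proof. by rewrite /lambda wb_circDr !addA. Qed.

Lemma lambdaN a b : lambda a (- b) = - lambda a b.
Proof.
apply/esym/(inv_unique addI).
  by rewrite -!lambdaD (opVK addI).
by rewrite -!lambdaD (invVK addI).
Qed.

(** Additivity of [lambda a] leaves an inner [a + - a], absorbed by [a ∘ (b ∘ c)]. *)
Lemma lambda_circ a b c : lambda (a ∘ b) c = lambda a (lambda b c).
Proof.
rewrite [lambda b c]/lambda lambdaD lambdaN /lambda (invM addI).
rewrite (inv_involutive addI) -circA -(addA _ a) (addA a).
by rewrite add_circK.
Qed.

(** The left side is [a + lambda (a ∘ a^v) b], and [a ∘ a^v = - a + a] is an idempotent that [a]
    absorbs. *)
Lemma circ_lambda_inv a b : a ∘ lambda a^v b = a + b.
Proof.
have a0 := idem_Vop addI a.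
rewrite -add_lambda -lambda_circ /lambda wb_circV circ_idem_add //.
by rewrite (inv_idem addI a0) !addA !(opVK addI).
Qed.

End DualWeakBrace.

Theorem proposition24 (S : dualWeakBrace) (I J : set S)
    (hI : is_ideal I) (hJ : is_ideal J) :
  is_ideal [set i + j | i in I & j in J] /\
  is_ideal [set i ∘ j | i in I & j in J].
Proof.
have eqIJ : [set i ∘ j | i in I & j in J] = [set i + j | i in I & j in J].
  apply/seteqP; split=> _ [i Ii [j Jj <-]].
    exists i => //; exists (lambda i j); last exact: add_lambda.
    by apply: (ideal_lambda hJ (a := i)); exists j.
  exists i => //; exists (lambda (wb_inv i) j); last exact: circ_lambda_inv.
  by apply: (ideal_lambda hJ (a := wb_inv i)); exists j.
have idealIJ : is_ideal [set i + j | i in I & j in J].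
  split.
  - by apply: (normal_setM (add_clifford S)); exact: ideal_add_normal.
  - move=> a _ [_ [i Ii [j Jj <-]] <-]; rewrite lambdaD.
    exists (lambda a i); first by apply: (ideal_lambda hI (a := a)); exists i.
    by exists (lambda a j) => //; apply: (ideal_lambda hJ (a := a)); exists j.
  (* Normality for [∘] is available for the set written as a [∘]-product. *)
  - rewrite -eqIJ.
    by apply: (normal_setM (dwb_clifford S)); exact: ideal_circ_normal.
by rewrite eqIJ.
Qed.
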